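(* An integer $n$ is admissible if and only if $n$ is even.
   Context: Let $\phi=\frac{1+\sqrt5}{2}$ and let $\Gamma^+$ be the semigroup generated by the matrices $\begin{pmatrix}1&\phi\\0&1\end{pmatrix}$, $\begin{pmatrix}1&0\\\phi&1\end{pmatrix}$, $\begin{pmatrix}\phi&\phi\\1&\phi\end{pmatrix}$, $\begin{pmatrix}\phi&1\\\phi&\phi\end{pmatrix}$. For $\gamma\in\Gamma^+$, write $\gamma\cdot(0,1)^t=(a+b\phi,\ c+d\phi)^t$ with $a,b,c,d\in\mathbb Z$ (uniquely determined since $\phi$ is irrational), and set $\ell=a+b+c+d$. Define $\mathcal L(\gamma)=2\ell$ if $(d-b)+2(c-a)\equiv 0 \pmod 5$, and $\mathcal L(\gamma)=10\ell$ otherwise. (This is the combinatorial period length of the pentagon billiard trajectory associated to $\gamma$.) An integer $n$ is called admissible if for every integer $q\ge1$ there exists $\gamma\in\Gamma^+$ with $\mathcal L(\gamma)\equiv n\pmod q$. *)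

(* Defs.v *)
From mathcomp Require Import all_boot all_order all_algebra.
From mathcomp Require Import boolp classical_sets reals.
From mathcomp Require Import zify ring.

Set Implicit Arguments.
Unset Strict Implicit.
Unset Printing Implicit Defensive.

Import Order.TTheory GRing.Theory Num.Theory.

Local Open Scope ring_scope.

Definition phi (R : realType) : R := (1 + Num.sqrt 5) / 2.

Definition mx22 (R : realType) (a b c d : R) : 'M[R]_2 :=
  \matrix_(i < 2, j < 2)
    if i == 0 then (if j == 0 then a else b) else (if j == 0 then c else d).

(* A semigroup: only nonempty products, the identity is not put in. *)
Inductive semigroup_gen (R : realType) (S : set 'M[R]_2) : set 'M[R]_2 :=
| semigroup_gen_in g : S g -> semigroup_gen S g
| semigroup_gen_mul g h :
    semigroup_gen S g -> semigroup_gen S h -> semigroup_gen S (g *m h).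

Definition Gamma_plus (R : realType) : set 'M[R]_2 :=
  let f := phi R in
  semigroup_gen [set mx22 1 f
                          0 1;
                     mx22 1 0
                          f 1;
                     mx22 f f
                          1 f;
                     mx22 f 1
                          f f]%classic.

(* The pair (a, b) with x = a + b phi, and the junk value (0, 0) if x is not
   in Z[phi]; see zphi_coordE and Gamma_plus_zphi below. *)
Definition zphi_coord (R : realType) (x : R) : int * int :=
  xget (0, 0) [set p : int * int | x = p.1%:~R + p.2%:~R * phi R]%classic.

Definition period_length (R : realType) (g : 'M[R]_2) : int :=
  let v : 'cV[R]_2 := g *m delta_mx 1 0 in
  let: (a, b) := zphi_coord (v 0 0) in
  let: (c, d) := zphi_coord (v 1 0) in
  let l := a + b + c + d in
  if (((d - b) + 2 * (c - a))%R == 0 %[mod 5])%Z then 2 * l else 10 * l.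

Definition admissible (R : realType) (n : int) : Prop :=
  forall q : nat, (1 <= q)%N ->
    exists2 g : 'M[R]_2, Gamma_plus g & (period_length g = n %[mod q])%Z.

Lemma phi_sqr (R : realType) : phi R ^+ 2 = phi R + 1.
Proof.
have h5 : Num.sqrt (5 : R) ^+ 2 = 5 by rewrite sqr_sqrtr // ler0n.
have -> : phi R ^+ 2 = (1 + 2 * Num.sqrt 5 + Num.sqrt 5 ^+ 2) / 4.
  by rewrite /phi; field.
by rewrite h5 /phi; field.
Qed.

Lemma sqr_eq_5sqr (x y : int) : x ^+ 2 = 5 * y ^+ 2 -> y = 0.
Proof.
move=> e; apply/eqP; case: (eqVneq y 0) => // y0.
have e' : (`|x| ^ 2 = 5 * `|y| ^ 2)%N.
  by move/(congr1 absz): e; rewrite abszX abszM abszX.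
have yp : (0 < `|y|)%N by rewrite absz_gt0.
have := congr1 (logn 5) e'.
rewrite lognX lognM ?expn_gt0 ?yp // lognX (_ : logn 5 5 = 1%N) //; lia.
Qed.

Lemma phi_irrational (R : realType) (a b : int) :
  a%:~R + b%:~R * phi R = 0 -> a = 0 /\ b = 0.
Proof.
move=> e.
have b0 : b = 0.
  apply: (@sqr_eq_5sqr (2 * a + b)); apply/eqP; rewrite -(eqr_int R).
  rewrite !(rmorphXn, rmorphM, rmorphD) /=.
  have /eqP := e; rewrite addr_eq0 => /eqP ->.
  apply/eqP; have := phi_sqr R; set f := phi R => hf.
  have -> : (2%:~R * - (b%:~R * f) + b%:~R) ^+ 2
            = b%:~R ^+ 2 * (4 * f ^+ 2 - 4 * f + 1) :> R by ring.
  by rewrite hf; ring.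
split=> //; move: e; rewrite b0 mul0r addr0 => /eqP.
by rewrite intr_eq0 => /eqP.
Qed.

Lemma zphi_coordE (R : realType) (a b : int) :
  zphi_coord (a%:~R + b%:~R * phi R) = (a, b).
Proof.
rewrite /zphi_coord; apply: xget_unique => // -[c d] /= e.
have [|/eqP + /eqP] := @phi_irrational R (a - c) (b - d).
  by rewrite !rmorphB /= mulrBl addrACA e; ring.
by rewrite !subr_eq0 => /eqP-> /eqP->.
Qed.

Lemma Gamma_plus_zphi (R : realType) (g : 'M[R]_2) (i j : 'I_2) :
  Gamma_plus g ->
  exists a b : int, g i j = a%:~R + b%:~R * phi R.
Proof.
move=> gG; elim: gG i j => [{}g gS|{}g h _ IHg _ IHh] i j.
  have e0 : exists a b : int, 0 = a%:~R + b%:~R * phi R.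
    by exists 0, 0; ring.
  have e1 : exists a b : int, 1 = a%:~R + b%:~R * phi R.
    by exists 1, 0; ring.
  have ef : exists a b : int, phi R = a%:~R + b%:~R * phi R.
    by exists 0, 1; ring.
  by case: gS => [[[|]|]|] ->; rewrite mxE; case: ifP; case: ifP.
rewrite mxE big_ord_recr big_ord1 /=.
set k := widen_ord _ _; set m := ord_max.
have [a [b ->]] := IHg i k; have [c [d ->]] := IHh k j.
have [a' [b' ->]] := IHg i m; have [c' [d' ->]] := IHh m j.
exists (a * c + b * d + (a' * c' + b' * d')).
exists (a * d + b * c + b * d + (a' * d' + b' * c' + b' * d')).
rewrite !(rmorphD, rmorphM) /=; have := phi_sqr R; set f := phi R => hf.
transitivity (a%:~R * c%:~R + (a%:~R * d%:~R + b%:~R * c%:~R) * f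
  + b%:~R * d%:~R * f ^+ 2 + (a'%:~R * c'%:~R
  + (a'%:~R * d'%:~R + b'%:~R * c'%:~R) * f + b'%:~R * d'%:~R * f ^+ 2)).
  by ring.
by rewrite hf; ring.
Qed.

(* Main.v *)
(** With [U = [1, phi; 0, 1]] and [V = [1, 0; phi, 1]], the word [U^j V^m U^k]
    sends [(0, 1)^t] to a vector with
    [l = k + 1 + 2 m k + j (1 + 3 m k)].  The triple [(k, m, j)] modulo 5 can be
    chosen so that the period length is [2 l] and [l] has any prescribed residue
    modulo 5.  If moreover [1 + 3 m k] is a unit modulo [q], then letting [j]
    run through its class modulo 5 gives every [l] modulo [q] in that class. *)
Require Import Defs.
From mathcomp Require Import all_boot all_order all_algebra.
From mathcomp Require Import reals.
From mathcomp Require Import cyclic zify ring.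

Set Implicit Arguments.
Unset Strict Implicit.
Unset Printing Implicit Defensive.

Import Order.TTheory GRing.Theory Num.Theory.

Local Open Scope ring_scope.

Lemma mulmx22 (R : realType) (a b c d a' b' c' d' : R) :
  mx22 a b c d *m mx22 a' b' c' d' =
  mx22 (a * a' + b * c') (a * b' + b * d') (c * a' + d * c') (c * b' + d * d').
Proof.
apply/matrixP => i k; rewrite !mxE big_ord_recr big_ord1 !mxE /=.
by case: ifP; case: ifP.
Qed.

(** Powers of a generator; exponents start at 1 because the semigroup lacks the identity. *)
Lemma Gamma_plus_upper (R : realType) (j : nat) :
  Gamma_plus (mx22 1 (j.+1%:R * phi R) 0 1).
Proof.
elim: j => [|j IHj].
  by rewrite mul1r; apply: semigroup_gen_in; left; left; left.
have -> : mx22 1 (j.+2%:R * phi R) 0 1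
        = mx22 1 (j.+1%:R * phi R) 0 1 *m mx22 1 (1%:R * phi R) 0 1.
  by rewrite mulmx22; congr mx22; ring.
apply: semigroup_gen_mul => //.
by rewrite mul1r; apply: semigroup_gen_in; left; left; left.
Qed.

Lemma Gamma_plus_lower (R : realType) (m : nat) :
  Gamma_plus (mx22 1 0 (m.+1%:R * phi R) 1).
Proof.
elim: m => [|m IHm].
  by rewrite mul1r; apply: semigroup_gen_in; left; left; right.
have -> : mx22 1 0 (m.+2%:R * phi R) 1
        = mx22 1 0 (m.+1%:R * phi R) 1 *m mx22 1 0 (1%:R * phi R) 1.
  by rewrite mulmx22; congr mx22; ring.
apply: semigroup_gen_mul => //.
by rewrite mul1r; apply: semigroup_gen_in; left; left; right.
Qed.

Lemma period_lengthE (R : realType) (g : 'M[R]_2) (a b c d : int) :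
  g 0 1 = a%:~R + b%:~R * phi R -> g 1 1 = c%:~R + d%:~R * phi R ->
  period_length g =
    if (((d - b) + 2 * (c - a))%R == 0 %[mod 5])%Z
    then 2 * (a + b + c + d) else 10 * (a + b + c + d).
Proof.
by move=> gx gy; rewrite /period_length -colE !mxE gx gy !zphi_coordE.
Qed.

Lemma period_length_even (R : realType) (g : 'M[R]_2) :
  (2 %| period_length g)%Z.
Proof.
rewrite /period_length.
case: (zphi_coord _) => a b; case: (zphi_coord _) => c d.
by case: ifP => _; apply: dvdz_mulr.
Qed.

(** The congruence is the branch condition [(d - b) + 2 * (c - a) = 0] modulo 5 for this word, with
    terms moved across to avoid subtraction in [nat]. *)
Lemma period_length_word (R : realType) (k m j : nat) :
  (0 < k)%N -> (0 < m)%N -> (0 < j)%N ->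
  (2 + 3 * (m * k) = k + j * (1 + 4 * (m * k)) %[mod 5])%N ->
  exists2 g : 'M[R]_2, Gamma_plus g &
    period_length g =
      2 * (k + 1 + 2 * (m * k) + j * (1 + 3 * (m * k)))%N%:Z.
Proof.
case: k m j => [|k] [|m] [|j] // _ _ _ e5.
move: (Gamma_plus_upper R k) (Gamma_plus_lower R m) (Gamma_plus_upper R j).
move: k.+1 m.+1 j.+1 e5 => {}k {}m {}j e5 gk gm gj.
exists (mx22 1 (j%:R * phi R) 0 1 *m
        (mx22 1 0 (m%:R * phi R) 1 *m mx22 1 (k%:R * phi R) 0 1)).
  by do 2?[apply: semigroup_gen_mul => //].
rewrite !mulmx22.
have hf := phi_sqr R.
rewrite (@period_lengthE _ _ (j * (m * k))%N
  (k + j * (1 + 2 * (m * k)))%N (1 + m * k)%N (m * k)%N).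
- case: ifP => [_|/negP[]]; first by lia.
  move/eqP: e5; rewrite eqz_mod_dvd; lia.
- rewrite !mxE /= -!pmulrn !(natrD, natrM).
  move: (phi R) hf => f hf.
  transitivity (k%:R * f + j%:R * f + j%:R * m%:R * k%:R * f * f ^+ 2).
    by ring.
  by rewrite hf mulrDr mulr1 -mulrA -expr2 hf; ring.
- rewrite !mxE /= -!pmulrn !(natrD, natrM).
  move: (phi R) hf => f hf.
  transitivity (1 + m%:R * k%:R * f ^+ 2); first by ring.
  by rewrite hf; ring.
Qed.

(** If [m * k = 2] modulo 5, the second clause forces [j = k + 2], and the half-length becomes
    [3 * k + 4]. As [k] runs over the units this gives every residue but 4, which is obtained from
    [m * k = 4]. *)
Lemma residue_choice_mod5 (h : int) :
  exists k m j : nat, [/\ [&& 0 < k, 0 < m & 0 < j]%N,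
    (2 + 3 * (m * k) = k + j * (1 + 4 * (m * k)) %[mod 5])%N,
    ~~ (5 %| 1 + 3 * (m * k))%N &
    (5 %| h - (k + 1 + 2 * (m * k) + j * (1 + 3 * (m * k)))%N%:Z)%Z].
Proof.
have [e|[e|[e|[e|e]]]] : (5 %| h)%Z \/ (5 %| h - 1)%Z \/ (5 %| h - 2)%Z
  \/ (5 %| h - 3)%Z \/ (5 %| h - 4)%Z by lia.
- by exists 2, 1, 4; split=> //; lia.
- by exists 4, 3, 1; split=> //; lia.
- by exists 1, 2, 3; split=> //; lia.
(* Here [j] is 0 modulo 5; 5 is its least positive representative. *)
- by exists 3, 4, 5; split=> //; lia.
- by exists 2, 2, 1; split=> //; lia.
Qed.

(** The Chinese remainder theorem gives a natural [x], divisible by [u] and congruent to [e] modulo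
    [q]; take [t = x / u]. *)
Lemma coprime_solve (q u : nat) (e : int) :
  (0 < q)%N -> coprime q u -> exists t : nat, (q %| e - (t * u)%N%:Z)%Z.
Proof.
move=> q0 qu; pose r := `|(e %% q)%Z|%N.
have re : r%:Z = (e %% q)%Z by rewrite /r gez0_abs // modz_ge0 //; lia.
pose x := chinese q u r 0.
exists (x %/ u)%N.
have ux : (u %| x)%N by rewrite /dvdn chinese_modr // mod0n.
rewrite divnK // -eqz_mod_dvd modz_nat chinese_modl //.
by rewrite -modz_nat re modz_mod.
Qed.

Theorem theorem1p4 (R : realType) (n : int) :
  admissible R n <-> (2 %| n)%Z.
Proof.
split=> [/(_ 2 isT)[g _ e]|/dvdzP[h ->] q q0].
  by move: (period_length_even g) e; lia.
have [k [m [j [/and3P[k0 m0 j0] cond u5 h5]]]] := residue_choice_mod5 h.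
(* [M] is [m] modulo 5 and 0 modulo the prime-to-5 part of [q], so that
   [1 + 3 M k] is a unit modulo [q]. *)
pose Q := (q`_(5^'))%N; pose M := (m * Q ^ 4)%N.
have Q5 : coprime Q 5.
  by rewrite coprime_sym prime_coprime // -p'natE // part_pnat.
(* The exponent 4 in [M] is the totient of 5. *)
have Q41 : (Q ^ 4 = 1 %[mod 5])%N by exact: (Euler_exp_totient Q5).
have Mm : (M = m %[mod 5])%N by rewrite -modnMmr Q41 modnMmr muln1.
have M0 : (0 < M)%N by rewrite muln_gt0 m0 expn_gt0 part_gt0.
have NE : (M * k = m * k %[mod 5])%N by rewrite -modnMml Mm modnMml.
have JE : (j * (M * k) = j * (m * k) %[mod 5])%N by rewrite -modnMmr NE modnMmr.
have jE c x : (j * (1 + c * x) = j + c * (j * x))%N by ring.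
pose u := (1 + 3 * (M * k))%N.
have qu : coprime q u.
  (* At 5, [u] is [1 + 3 * (m * k)], nonzero modulo 5; away from 5, [u] is 1 modulo [Q]. *)
  rewrite -(partnC 5%N q0) coprimeMl p_part; apply/andP; split.
    apply: coprimeXl; rewrite prime_coprime //; move: u5 NE; rewrite /u; lia.
  have -> : u = (3 * m * k * Q ^ 3 * Q + 1)%N by rewrite /u /M; ring.
  by rewrite /coprime gcdnMDl gcdn1.
have /dvdzP[e he] : (5 %| h - (k + 1 + 2 * (M * k) + j * u)%N%:Z)%Z.
  rewrite /u; move: h5 NE JE; rewrite !jE; lia.
(* Replacing [j] by [j + 5 * t] keeps all conditions modulo 5 and adds [5 * t * u] to the
   half-length, which misses [h] by [5 * e]; so [t * u = e] modulo [q] suffices. *)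
have [t ht] := coprime_solve e q0 qu.
have [||g gG gE] := @period_length_word R k M (j + 5 * t) k0 M0.
- by rewrite addn_gt0 j0.
- move: cond NE JE.
  by rewrite mulnDl -mulnA !jE; lia.
exists g => //; apply/eqP; rewrite gE eqz_mod_dvd.
have -> : 2 * (k + 1 + 2 * (M * k) + (j + 5 * t) * u)%N%:Z - h * 2
        = - 10 * (e - (t * u)%N%:Z).
  rewrite mulnDl -!mulnA; move: he; lia.
exact: dvdz_mull.
Qed.
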